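(* Let $n$ be a positive integer and let $S$ be the unit sphere of $\mathbb{C}^n$. If $\Omega\subset Q$ is an $L^\infty(S)$-algebra pattern that contains some $(p,q)$ with $p>q$ and some $(r,s)$ with $r<s$, then $\Omega=G(d)$ for some integer $d>0$.
   Context: $\sigma$ is the unique rotation-invariant (i.e. $O(2n)$-invariant) positive Borel measure on $S$ with $\sigma(S)=1$, and $L^p(S)=L^p(S,\sigma)$ (complex-valued). The weak*-topology on $L^\infty(S)$ is the one it carries as the dual of $L^1(S)$, via the functionals $f\mapsto\int_S fg\,d\sigma$, $g\in L^1(S)$. $Q$ is the set of pairs $(p,q)$ of nonnegative integers. For $(p,q)\in Q$, $H(p,q)$ is the space of restrictions to $S$ of harmonic polynomials on $\mathbb{C}^n$ that are homogeneous of degree $p$ in $z_1,\dots,z_n$ and homogeneous of degree $q$ in $\bar z_1,\dots,\bar z_n$. For $\Omega\subset Q$, $E_\Omega$ is the set of all finite sums of elements of the spaces $H(p,q)$ with $(p,q)\in\Omega$, and $\overline{E}_\Omega^{*}$ is its weak*-closure in $L^\infty(S)$. $\Omega$ is an $L^\infty(S)$-algebra pattern if $\overline{E}_\Omega^{*}$ is an algebra in $L^\infty(S)$, i.e. a linear subspace closed under pointwise multiplication (it need not contain the constants). For an integer $k$, $\Delta_k=\{(p,q)\in Q: p-q=k\}$. For an integer $d$, $G(d)$ is the union of all $\Delta_{kd}$ for integers $-\infty<k<\infty$.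
   Formalization: For n = 1 the claim fails as stated (H(p,q) = {0} when p,q > 0, so Ω = {(p,0)} ∪ {(0,q)} is a pattern but no G(d)); in that dimension only, Q, and with it Ω, Δ_k and G(d), is restricted to pairs with p = 0 or q = 0. *)

(* Defs.v *)
From HB Require Import structures.
From mathcomp Require Import all_boot all_order all_algebra.
From mathcomp Require Import complex.
From mathcomp Require mpoly.
From mathcomp Require Import all_classical all_reals all_analysis.
Import -(notations) mpoly.

Set Implicit Arguments.
Unset Strict Implicit.
Unset Printing Implicit Defensive.

Import Order.TTheory GRing.Theory Num.Theory.
Import numFieldNormedType.Exports.

Local Open Scope classical_set_scope.
Local Open Scope ring_scope.
Local Open Scope complex_scope.

(* Throughout, n : nat stands for the dimension n.+1 >= 1, and C^(n.+1) is     *)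
(* identified with R^(n.+1 + n.+1): the point with real coordinates (x, y) is  *)
(* z = x + i y, where x_j and y_j sit at the indices [lshift _ j], [rshift _ j]. *)

Section Sphere.
Variables (R : realType) (n : nat).

Definition sphere_set : set 'rV[R]_(n.+1 + n.+1) :=
  [set x | \sum_j x 0 j ^+ 2 = 1].

Lemma sphere_set_delta : sphere_set (delta_mx 0 ord0).
Proof.
rewrite /sphere_set /= (bigD1 ord0) //= mxE !eqxx expr1n big1 ?addr0 // => j.
by move=> /negPf j0; rewrite mxE j0 andbF expr0n.
Qed.

Definition sphere : Type := set_type sphere_set.

HB.instance Definition _ := Topological.copy sphere (set_type sphere_set).
HB.instance Definition _ := isPointed.Build sphere
  (exist (fun x => x \in sphere_set) _ (mem_set sphere_set_delta)).

Definition borel_sphere := g_sigma_algebraType (@open sphere).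

Lemma sphere_set_rot (U : 'M[R]_(n.+1 + n.+1)) (x : 'rV[R]_(n.+1 + n.+1)) :
  U *m U^T = 1%:M -> sphere_set x -> sphere_set (x *m U).
Proof.
have sqE (y : 'rV[R]_(n.+1 + n.+1)) : \sum_j y 0 j ^+ 2 = (y *m y^T) 0 0.
  by rewrite mxE; apply: eq_bigr => j _; rewrite mxE expr2.
move=> UU; rewrite /sphere_set /= !sqE => xx.
by rewrite trmx_mul mulmxA -(mulmxA x) UU mulmx1.
Qed.

Definition sphere_rot (U : 'M[R]_(n.+1 + n.+1)) (UU : U *m U^T = 1%:M) (x : sphere) :
    sphere :=
  exist (fun x => x \in sphere_set) _
    (mem_set (sphere_set_rot UU (set_mem (valP x)))).

Definition rotation_invariant (sigma : set borel_sphere -> \bar R) : Prop :=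
  forall (U : 'M[R]_(n.+1 + n.+1)) (UU : U *m U^T = 1%:M) (A : set borel_sphere),
    measurable A -> sigma (sphere_rot UU @^-1` A) = sigma A.

End Sphere.

Section HarmonicSpaces.
Variables (R : realType) (n : nat).

(* Polynomials in the real coordinates (x, y), with complex coefficients.      *)
Local Notation poly_xy := (mpoly (n.+1 + n.+1) R[i]).

(* The polynomials z_j = x_j + i y_j, followed by their conjugates.            *)
Definition zzbar (k : 'I_(n.+1 + n.+1)) : poly_xy :=
  match fintype.split k with
  | inl j => mpolyX _ (mnm1 (lshift n.+1 j))
               + 'i%C *: mpolyX _ (mnm1 (rshift n.+1 j))
  | inr j => mpolyX _ (mnm1 (lshift n.+1 j))
               - 'i%C *: mpolyX _ (mnm1 (rshift n.+1 j))
  end.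

(* P = Q(z_1, .., conj z_1, ..), where every monomial of Q has degree p in the *)
(* first n.+1 variables and degree q in the last n.+1 ones.                    *)
Definition bihomogeneous (p q : nat) (P : poly_xy) : Prop :=
  exists Q : poly_xy,
    (forall m, m \in msupp Q ->
       (\sum_j m (lshift n.+1 j))%N = p /\ (\sum_j m (rshift n.+1 j))%N = q) /\
    P = comp_mpoly [tuple zzbar k | k < n.+1 + n.+1] Q.

Definition laplacian (P : poly_xy) : poly_xy := \sum_k mderiv k (mderiv k P).

Definition restr (P : poly_xy) (x : sphere R n) : R[i] :=
  meval (fun k => (val x 0 k)%:C) P.

Definition harmonic_space (p q : nat) : set (sphere R n -> R[i]) :=
  [set restr P | P in [set P | bihomogeneous p q P /\ laplacian P = 0]].

Definition E_ (Omega : set (nat * nat)) : set (sphere R n -> R[i]) :=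
  [set f | exists s : seq (sphere R n -> R[i]),
     (forall g, g \in s -> exists2 pq, Omega pq & harmonic_space pq.1 pq.2 g) /\
     f = fun x => \sum_(g <- s) g x].

End HarmonicSpaces.

Section WeakStar.
Variables (R : realType) (n : nat).
Variable sigma : {measure set (borel_sphere R n) -> \bar R}.

Definition LC (p : \bar R) : set (borel_sphere R n -> R[i]) :=
  [set f : borel_sphere R n -> R[i] |
     (@complex.Re R \o f) \in Lfun sigma p /\ (@complex.Im R \o f) \in Lfun sigma p].

Definition Cintegral (f : borel_sphere R n -> R[i]) : R[i] :=
  Complex (\int[sigma]_x complex.Re (f x)) (\int[sigma]_x complex.Im (f x)).

(* Functions are not identified when they agree almost everywhere; the weak*   *)
(* topology does not separate such functions, so that weak*-closed sets are    *)
(* exactly the unions of almost-everywhere classes forming a weak*-closed set. *)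
Definition pairing (f : LC +oo%E) : {ptws LC 1%E -> R[i]^o} :=
  fun g => Cintegral (fun x => val f x * val g x).

Definition weakstar_closure (A : set (borel_sphere R n -> R[i])) :
    set (borel_sphere R n -> R[i]) :=
  [set val f | f in
     closure ((fun f => A (val f)) : set (initial_topology pairing))].

Definition is_algebra (A : set (borel_sphere R n -> R[i])) : Prop :=
  [/\ A (fun=> 0),
      forall f g, A f -> A g -> A (fun x => f x + g x),
      forall (c : R[i]) f, A f -> A (fun x => c * f x) &
      forall f g, A f -> A g -> A (fun x => f x * g x)].

Definition Linfty_algebra_pattern (Omega : set (nat * nat)) : Prop :=
  is_algebra (weakstar_closure (E_ Omega)).

End WeakStar.

Section Patterns.
Variable n : nat.

(* In C^1 one has z * conj z = 1 on the circle, and z^p (conj z)^q is not      *)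
(* harmonic when p, q > 0: the spaces H(p, q) with p, q > 0 are then {0} and   *)
(* adding or removing such pairs does not change E_Omega, so a set of pairs is *)
(* not determined by its E_Omega. In dimension 1 the index set is therefore    *)
(* restricted to the pairs with p = 0 or q = 0; in dimension > 1 there is no   *)
(* restriction.                                                                *)
Definition Q_ : set (nat * nat) :=
  [set pq | (1 < n.+1)%N \/ pq.1 = 0%N \/ pq.2 = 0%N].

Definition Delta (k : int) : set (nat * nat) :=
  [set pq | Q_ pq /\ pq.1%:Z - pq.2%:Z = k].

Definition G_ (d : int) : set (nat * nat) := \bigcup_(k in [set: int]) Delta (k * d).

End Patterns.

(* Main.v *)
(* The conjugate of H(p,q) is H(q,p), and a product of f in H(p,q) and g in     *)
(* H(r,s) that is not orthogonal to H(a,b) forces (a,b) into the pattern. So    *)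
(* everything reduces to showing that a few integrals of f g h do not vanish,   *)
(* and that H(p,q) and H(q',p') are orthogonal for the bilinear integral unless *)
(* (p',q') = (p,q). Differentiating the invariance under plane rotations gives, *)
(* for P homogeneous of degree d in N real variables,                           *)
(*   integral of Laplacian P = d (d + N - 2) * integral of P.                   *)
(* Applied to a product of harmonic polynomials this yields orthogonality by    *)
(* induction on degrees; applied to monomials it evaluates the moments          *)
(* |z_1|^(2a) |z_2|^(2b). In dimension > 1, monomials z_1^p conj(z_2)^q then    *)
(* show that a pattern is closed under                                          *)
(*   (p,q), (r,s)     |-> (p+r,q+s),                                            *)
(*   (p+r,q+s), (s,r) |-> (p,q),                                                *)
(*   (p,q), (r,s)     |-> (p+r-1,q+s-1)   when p > q and r < s.                 *)
(* From p > q and r < s one gets (a,a) and (a-1,a-1), hence (1,1), hence whole  *)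
(* diagonals; the differences p - q form a subgroup of the integers.            *)

From HB Require Import structures.
Require Import Defs.
From mathcomp Require Import all_boot all_order all_algebra.
From mathcomp Require Import complex.
From mathcomp Require mpoly.
From mathcomp Require Import all_classical all_reals all_analysis.
From mathcomp Require Import measurable_realfun.
From mathcomp Require Import ring zify.
Import -(notations) mpoly.

Set Implicit Arguments.
Unset Strict Implicit.
Unset Printing Implicit Defensive.

Import Order.TTheory GRing.Theory Num.Theory.
Import numFieldNormedType.Exports.
Local Open Scope classical_set_scope.
Local Open Scope ring_scope.

(** Membership in a pattern is tested by integrals of three harmonic factors. If (a,b) is not in
    Omega, then H(b,a) annihilates every H(c,e) with (c,e) in Omega ([Lam_orth]). It therefore
    annihilates the weak*-closure of E_Omega, which contains the product of any two of its harmonic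
    elements. Hence one nonvanishing integral puts (a,b) into Omega ([pattern_triple]). The
    orthogonality and the nonvanishing both rest on one identity for the integral ([scalar_lap]). It
    follows from rotation invariance, since the spherical Laplacian is a sum of terms in the images
    of the rotation generators. The algebra is done for an abstract linear functional [Lam] on
    polynomials in z and conj z, treated as independent variables; the integral over the sphere is
    substituted only at the end. With two distinct coordinates, the test functions of
    [triple_nonzero_top] and [triple_nonzero_subtop] give the closure rules, and [pattern_shift]
    fills whole diagonals. In dimension 1 only powers of z and of conj z occur, a diagonal is a
    single pair, and the one-variable integrals suffice. In both cases [pattern_of_differences]
    concludes from the additive structure of the differences p - q. *)

Lemma mpoly_ring_ind (N : nat) (K : comRingType) (P : mpoly N K -> Prop) :
    (forall c, P (mpolyC N c)) -> (forall i, P (mpolyX K (mnm1 i))) ->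
    (forall p q, P p -> P q -> P (p + q)) ->
    (forall p q, P p -> P q -> P (p * q)) ->
  forall p, P p.
Proof.
move=> PC PX PD PM.
have P1 : P 1 by rewrite -mpolyC1; exact: PC.
apply: mpolyind => [|c m p _ _ Pp]; first by rewrite -mpolyC0; exact: PC.
apply: PD => //; rewrite -mul_mpolyC; apply: (PM) => //.
rewrite mpolyXE_id; apply: (big_ind P P1 PM) => i _.
by elim: (m i) => [|k IH]; rewrite ?expr0 ?exprS//; exact: PM.
Qed.

(** * Rotation generators on polynomials *)

Section PolynomialCalculus.
Variables (N : nat) (K : numFieldType).
Local Notation A := (mpoly N K).
Local Notation X i := (mpolyX K (mnm1 i) : A).

Lemma mderiv_var (i k : 'I_N) : mderiv k (X i) = (i == k)%:R.
Proof.
rewrite mderivX mnm1E; case: eqVneq => [->|]; last by rewrite scale0r.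
rewrite (_ : mnm_sub _ _ = mnm0) ?mpolyX0 ?scale1r //.
by apply/mnmP=> j; rewrite mnmBE mnm0E subnn.
Qed.

Lemma mderiv_comp_mpoly (lq : N.-tuple A) k p :
  mderiv k (comp_mpoly lq p) =
  \sum_i comp_mpoly lq (mderiv i p) * mderiv k (tnth lq i).
Proof.
elim/mpoly_ring_ind: p => [c|i|p q IHp IHq|p q IHp IHq].
- rewrite comp_mpolyC mderivC big1 // => i _.
  by rewrite mderivC comp_mpoly0 mul0r.
- rewrite comp_mpolyXU (bigD1 i) //= big1 => [|j ji].
    by rewrite mderiv_var eqxx rmorph1 mul1r addr0 -tnth_nth.
  by rewrite mderiv_var eq_sym (negPf ji) rmorph0 mul0r.
- rewrite comp_mpolyD mderivD IHp IHq -big_split; apply: eq_bigr => i _ /=.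
  by rewrite mderivD comp_mpolyD mulrDl.
- rewrite rmorphM mderivM IHp IHq mulr_suml mulr_sumr -big_split.
  apply: eq_bigr => i _ /=; rewrite mderivM rmorphD !rmorphM /=; ring.
Qed.

(** The vector field generating the rotations of the (j, k)-plane. *)
Definition rot_gen (j k : 'I_N) (p : A) : A :=
  X j * mderiv k p - X k * mderiv j p.

(* The coordinates of (1 + t^2) U x, with U the rotation of the (j, k)-plane    *)
(* of cosine (1 - t^2) / (1 + t^2) and sine 2 t / (1 + t^2): this rational      *)
(* parametrization makes differentiation in t a matter of coefficients.         *)
Definition scaled_rot (j k i : 'I_N) : {poly A} :=
  if i == k then (X k)%:P * (1 - 'X^2) + (X j *+ 2)%:P * 'X
  else if i == j then (X j)%:P * (1 - 'X^2) - (X k *+ 2)%:P * 'X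
  else (X i)%:P * (1 + 'X^2).

Definition scaled_rotate (j k : 'I_N) : A -> {poly A} :=
  mmap (polyC \o @mpolyC N K) (scaled_rot j k).

Lemma coef01M (R : nzRingType) (p q : {poly R}) :
  (p * q)`_1 = p`_0 * q`_1 + p`_1 * q`_0.
Proof. by rewrite coefM !big_ord_recl big_ord0 addr0. Qed.

(** Modulo t^2 the substitution is the identity plus 2 t times the generator. Both coefficients are
    treated together because the Leibniz rule for the coefficient of t involves the constant
    ones. *)
Lemma scaled_rotate_coef j k p : j != k ->
  (scaled_rotate j k p)`_0 = p /\ (scaled_rotate j k p)`_1 = rot_gen j k p *+ 2.
Proof.
move=> jk; elim/mpoly_ring_ind: p => [c|i|p q [p0 p1] [q0 q1]|p q [p0 p1] [q0 q1]].
- by rewrite /scaled_rotate mmapC /= !coefC /= /rot_gen !mderivC !mulr0 subr0 mul0rn.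
- rewrite /scaled_rotate mmapX mmap1U /scaled_rot /rot_gen !mderiv_var.
  have kj : (k == j) = false by rewrite eq_sym (negPf jk).
  have coefs := (coefD, coefN, coefCM, coefXn, coefX, coef1).
  have [->|ik] := eqVneq i k.
    by rewrite !coefs kj /=; split; ring.
  have [->|ij] := eqVneq i j.
    by rewrite !coefs /=; split; ring.
  by rewrite !coefs /=; split; ring.
- have -> : scaled_rotate j k (p + q) = scaled_rotate j k p + scaled_rotate j k q.
    exact: mmapD.
  move: (scaled_rotate j k p) (scaled_rotate j k q) p0 p1 q0 q1 => P Q p0 p1 q0 q1.
  by rewrite !coefD p0 p1 q0 q1 /rot_gen !mderivD; split=> //; ring.
- have -> : scaled_rotate j k (p * q) = scaled_rotate j k p * scaled_rotate j k q.
    exact: rmorphM.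
  move: (scaled_rotate j k p) (scaled_rotate j k q) p0 p1 q0 q1 => P Q p0 p1 q0 q1.
  by rewrite coef01M coef0M p0 p1 q0 q1 /rot_gen !mderivM; split=> //; ring.
Qed.

Definition euler (p : A) : A := \sum_k X k * mderiv k p.

Definition lap (p : A) : A := \sum_k mderiv k (mderiv k p).

(** Pairing the terms (j, k) and (k, j) turns the double sum into the sum over j < k of the squared
    generators, which is the spherical Laplacian. In this form each summand visibly lies in the
    image of a generator. *)
Lemma sum_rot_gen p :
  \sum_j \sum_k rot_gen j k (X j * mderiv k p) + euler (euler p) + euler p *+ N =
  (\sum_j X j ^+ 2) * lap p + euler p *+ 2.
Proof.
have -> : euler p *+ N = \sum_(j < N) \sum_k X k * mderiv k p.
  by rewrite sumr_const card_ord.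
(* A Kronecker delta turns this into a double sum, so that the identity can be checked for each pair
   (j, k). *)
have -> : euler p *+ 2 = \sum_(j < N) \sum_k ((j == k)%:R * (X j * mderiv k p)) *+ 2.
  rewrite /euler -sumrMnl; apply: eq_bigr => j _.
  rewrite (bigD1 j) //= eqxx big1 ?addr0 ?mul1r //.
  by move=> k kj; rewrite eq_sym (negPf kj) mul0r mul0rn.
rewrite mulr_suml [euler (euler p)]/euler -!big_split /=; apply: eq_bigr => j _.
rewrite /euler /lap raddf_sum /= !mulr_sumr -!big_split /=; apply: eq_bigr => k _.
rewrite /rot_gen !mderivM !mderiv_var (eq_sym k j) eqxx /=.
by case: eqVneq => [->|_]; ring.
Qed.

Lemma poly_nat_roots0 (p : {poly K}) : (forall t : nat, p.[t%:R] = 0) -> p = 0.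
Proof.
move=> p0; apply/eqP/negPn/negP => pn0.
have := max_poly_roots (rs := [seq i%:R | i <- iota 0 (size p)]) pn0.
rewrite size_map size_iota ltnn => /(_ _ _)/= H; suff: false by [].
apply: H; first by apply/allP => _ /mapP[i _ ->]; rewrite /root p0.
by rewrite map_inj_uniq ?iota_uniq // => i j /eqP; rewrite eqr_nat => /eqP.
Qed.

(** On a monomial, applying [Lam] coefficientwise gives a polynomial in t that agrees with a
    multiple of (1 + t^2)^d at all naturals, hence identically. The latter is even, so its
    coefficient of t is 0, while the former has twice the value on the generator. *)
Lemma scalar_rot_gen (Lam : {scalar A}) j k p : j != k ->
    (forall (t : nat) m, Lam (scaled_rotate j k (mpolyX K m)).[t%:R] =
                         (1 + t%:R ^+ 2) ^+ mdeg m * Lam (mpolyX K m)) ->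
  Lam (rot_gen j k p) = 0.
Proof.
move=> jk Lrot.
apply: (mpolyind (P := fun p => Lam (rot_gen j k p) = 0)) => [|c m q _ _ IH].
  by rewrite /rot_gen !raddf0 !mulr0 subr0 raddf0.
have -> : rot_gen j k (c *: mpolyX K m + q) =
    c *: rot_gen j k (mpolyX K m) + rot_gen j k q.
  by rewrite /rot_gen !linearP /= -!mul_mpolyC; ring.
rewrite linearP IH addr0; apply/eqP; rewrite mulf_eq0; apply/orP; right.
have [_ s1] := scaled_rotate_coef (mpolyX K m) jk.
set s := scaled_rotate j k _ in Lrot s1.
have: map_poly Lam s - (Lam (mpolyX K m))%:P * (1 + 'X^2) ^+ mdeg m = 0.
  apply: poly_nat_roots0 => t; rewrite !hornerE /= mulrC -Lrot.
  apply/eqP; rewrite subr_eq0.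
  rewrite horner_poly horner_coef raddf_sum; apply/eqP; apply: eq_bigr => i _ /=.
  by rewrite -!natrX !mulr_natr raddfMn.
move/(congr1 (fun p : {poly K} => p`_1)); rewrite coefB coef_map s1 raddfMn coefCM coef0.
have -> : ((1 + 'X^2 : {poly K}) ^+ mdeg m)`_1 = 0.
  elim: (mdeg m) => [|d IHd]; first by rewrite expr0 coef1.
  by rewrite exprS coef01M IHd !coefD !coef1 !coefXn /= !add0r mul0r mulr0 addr0.
by rewrite mulr0 subr0 => /eqP; rewrite mulrn_eq0.
Qed.

Lemma rot_gen_id j p : rot_gen j j p = 0.
Proof. by rewrite /rot_gen subrr. Qed.

Lemma scalar_lap (Lam : {scalar A}) p :
    (forall j k q, j != k -> Lam (rot_gen j k q) = 0) ->
    (forall q, Lam ((\sum_j X j ^+ 2) * q) = Lam q) ->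
  Lam (lap p) + Lam (euler p) *+ 2 = Lam (euler (euler p)) + Lam (euler p) *+ N.
Proof.
move=> Lrot Lsph; have := congr1 Lam (sum_rot_gen p).
rewrite !raddfD /= !raddfMn Lsph => <-; rewrite raddf_sum big1 ?add0r // => j _.
rewrite raddf_sum big1 // => k _; have [->|jk] := eqVneq j k; last exact: Lrot.
by rewrite rot_gen_id raddf0.
Qed.

End PolynomialCalculus.

Section Euler.
Variables (N : nat) (K : numFieldType).
Local Notation A := (mpoly N K).

Lemma euler_is_linear : linear (@euler N K).
Proof.
move=> c f g; rewrite /euler scaler_sumr -big_split; apply: eq_bigr => k _ /=.
by rewrite linearP mulrDr scalerAr.
Qed.
HB.instance Definition _ := GRing.isLinear.Build K A A _ (@euler N K) euler_is_linear.

Lemma eulerM (f g : A) : euler (f * g) = euler f * g + f * euler g.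
Proof.
rewrite /euler mulr_suml mulr_sumr -big_split; apply: eq_bigr => k _ /=.
by rewrite mderivM; ring.
Qed.

Lemma euler_monomial m : euler (mpolyX K m : A) = (mdeg m)%:R *: mpolyX K m.
Proof.
rewrite /euler mdegE natr_sum scaler_suml; apply: eq_bigr => k _.
rewrite mderivX -scalerAr -mpolyXD; have [->|mk] := eqVneq (m k) 0%N.
  by rewrite !scale0r.
by rewrite addmC submK // lep1mP.
Qed.

End Euler.

(** * Harmonic polynomials in the variables z, conj z *)

Section Bidegree.
Variables (n : nat) (K : numFieldType).
Local Notation A := (mpoly (n.+1 + n.+1) K).
Local Notation Z i := (mpolyX K (mnm1 (lshift n.+1 i)) : A).
Local Notation W i := (mpolyX K (mnm1 (rshift n.+1 i)) : A).
Local Notation dz i := (@mderiv (n.+1 + n.+1) K (lshift n.+1 i)).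
Local Notation dw i := (@mderiv (n.+1 + n.+1) K (rshift n.+1 i)).

Definition bidegree (p q : nat) (f : A) : Prop :=
  forall m, m \in msupp f ->
    (\sum_j m (lshift n.+1 j))%N = p /\ (\sum_j m (rshift n.+1 j))%N = q.

Definition zw_lap (f : A) : A := \sum_j dw j (dz j f).

Lemma bidegreeM p q r s f g :
  bidegree p q f -> bidegree r s g -> bidegree (p + r) (q + s) (f * g).
Proof.
move=> fpq grs m /msuppM_le /allpairsP[[m1 m2] /= [/fpq[<- <-] /grs[<- <-] ->]].
by rewrite -!big_split /=; split; apply: eq_bigr => j _; rewrite mnmDE.
Qed.

Lemma bidegree0 p q : bidegree p q 0.
Proof. by move=> m; rewrite -mpolyC0 msupp0. Qed.

Lemma bidegreeD p q f g :
  bidegree p q f -> bidegree p q g -> bidegree p q (f + g).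
Proof. by move=> fpq gpq m /msuppD_le; rewrite mem_cat => /orP[/fpq|/gpq]. Qed.

Lemma bidegreeZ p q c f : bidegree p q f -> bidegree p q (c *: f).
Proof. by move=> fpq m /msuppZ_le /fpq. Qed.

Lemma bidegree1 : bidegree 0 0 1.
Proof.
move=> m; rewrite -mpolyC1 msuppC oner_eq0 inE => /eqP ->.
by split; apply: big1 => j _; rewrite mnm0E.
Qed.

Lemma bidegree_Zexp i a : bidegree a 0 (Z i ^+ a).
Proof.
elim: a => [|a IH]; first exact: bidegree1.
rewrite exprS -addn1 addnC -[0%N]addn0; apply: bidegreeM => //.
move=> m; rewrite msuppX inE => /eqP ->; split; last first.
  by apply: big1 => j _; rewrite mnm1E eq_lrshift.
rewrite (bigD1 i) //= mnm1E eqxx big1 // => j ji.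
by rewrite mnm1E eq_lshift eq_sym (negPf ji).
Qed.

Lemma bidegree_Wexp i a : bidegree 0 a (W i ^+ a).
Proof.
elim: a => [|a IH]; first exact: bidegree1.
rewrite exprS -addn1 addnC -[0%N]addn0; apply: bidegreeM => //.
move=> m; rewrite msuppX inE => /eqP ->; split.
  by apply: big1 => j _; rewrite mnm1E eq_rlshift.
rewrite (bigD1 i) //= mnm1E eqxx big1 // => j ji.
by rewrite mnm1E eq_rshift eq_sym (negPf ji).
Qed.

(** The disjunction avoids a truncated p.-1, so that [Lam_orth] can shift degrees exactly and keep
    its bidegrees apart. *)
Lemma bidegree_dz i p q f : bidegree p q f ->
  dz i f = 0 \/ exists2 p', p = p'.+1 & bidegree p' q (dz i f).
Proof.
move=> fpq; have H m : m \in msupp (dz i f) ->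
    (\sum_j m (lshift n.+1 j))%N.+1 = p /\ (\sum_j m (rshift n.+1 j))%N = q.
  rewrite mcoeff_msupp mcoeff_mderiv mulrn_eq0 /= -mcoeff_msupp => /fpq[<- <-].
  split; last by apply: eq_bigr => j _; rewrite mnmDE mnm1E eq_lrshift addn0.
  under [RHS]eq_bigr => j _ do rewrite mnmDE mnm1E eq_lshift eq_sym.
  rewrite big_split /= -addn1; congr addn.
  by rewrite (bigD1 i) //= eqxx big1 // => j /negPf ->.
case: p fpq H => [|p] fpq H; last first.
  by right; exists p => // m /H[[]].
left; apply: msuppnil0; case: msupp H => // m s /(_ m); rewrite inE eqxx.
by move=> /(_ isT)[].
Qed.

Lemma bidegree_dw i p q f : bidegree p q f ->
  dw i f = 0 \/ exists2 q', q = q'.+1 & bidegree p q' (dw i f).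
Proof.
move=> fpq; have H m : m \in msupp (dw i f) ->
    (\sum_j m (lshift n.+1 j))%N = p /\ (\sum_j m (rshift n.+1 j))%N.+1 = q.
  rewrite mcoeff_msupp mcoeff_mderiv mulrn_eq0 /= -mcoeff_msupp => /fpq[<- <-].
  split; first by apply: eq_bigr => j _; rewrite mnmDE mnm1E eq_rlshift addn0.
  under [RHS]eq_bigr => j _ do rewrite mnmDE mnm1E eq_rshift eq_sym.
  rewrite big_split /= -addn1; congr addn.
  by rewrite (bigD1 i) //= eqxx big1 // => j /negPf ->.
case: q fpq H => [|q] fpq H; last first.
  by right; exists q => // m /H[? []].
left; apply: msuppnil0; case: msupp H => // m s /(_ m); rewrite inE eqxx.
by move=> /(_ isT)[].
Qed.

Lemma euler_bidegree p q (f : A) : bidegree p q f -> euler f = (p + q)%:R *: f.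
Proof.
move=> fpq; rewrite [in LHS](mpolyE f) [in RHS](mpolyE f) scaler_sumr raddf_sum.
rewrite big_seq [RHS]big_seq; apply: eq_bigr => m /fpq [mp mq].
by rewrite [LHS]linearZ /= euler_monomial mdegE big_split_ord mp mq !scalerA mulrC.
Qed.

Lemma zw_lap_is_linear : linear zw_lap.
Proof.
move=> c f g; rewrite /zw_lap scaler_sumr -big_split; apply: eq_bigr => k _ /=.
by rewrite !linearP.
Qed.
HB.instance Definition _ := GRing.isLinear.Build K A A _ zw_lap zw_lap_is_linear.

Lemma zw_lapM (f g : A) : zw_lap (f * g) = zw_lap f * g + f * zw_lap g +
  \sum_j (dw j f * dz j g + dz j f * dw j g).
Proof.
rewrite /zw_lap mulr_suml mulr_sumr -!big_split; apply: eq_bigr => k _ /=.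
by rewrite !mderivM !mderivD !mderivM; ring.
Qed.

Lemma zw_lap_mderiv k (f : A) : zw_lap (mderiv k f) = mderiv k (zw_lap f).
Proof.
rewrite /zw_lap raddf_sum; apply: eq_bigr => j _ /=.
by rewrite (mderiv_comm k) (mderiv_comm k).
Qed.

(* [Lam] stands for the integral over the unit sphere. Up to the factor 4,      *)
(* [zw_lap] is the Laplacian and [euler] is the radial derivative, so that      *)
(* [Lam_lap] is Green's identity: the spherical Laplacian has integral 0.       *)
Variable Lam : {scalar A}.
Hypothesis Lam1 : Lam 1 = 1.
Hypothesis Lam_lap : forall f,
  Lam (zw_lap f) *+ 4 + Lam (euler f) *+ 2 =
  Lam (euler (euler f)) + Lam (euler f) *+ (n.+1 + n.+1).

(** With N = 2 (n + 1) real variables, d + N - 2 is d + 2 n. *)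
Lemma Lam_lap_deg d f : euler f = d%:R *: f ->
  Lam (zw_lap f) *+ 4 = (d * (d + n.*2))%:R * Lam f.
Proof.
move=> fd; have := Lam_lap f; rewrite fd !linearZ /= fd !linearZ /=.
rewrite -addnn natrM !natrD => H; apply: (addIr ((d%:R * Lam f) *+ 2)); rewrite H; ring.
Qed.

(** Induction on the total degree. For harmonic factors only the cross terms of [zw_lap (f * g)]
    survive. Each is a product of harmonic derivatives whose bidegrees are again not swaps of each
    other, so it integrates to 0. The factor of [Lam_lap_deg] is nonzero because total degree 0
    would make both bidegrees (0,0). *)
Lemma Lam_orth (p q r s : nat) f g : bidegree p q f -> bidegree r s g ->
  zw_lap f = 0 -> zw_lap g = 0 -> (r, s) <> (q, p) -> Lam (f * g) = 0.
Proof.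
have [N] := ubnP (p + q + (r + s)); elim: N => // N IH in p q r s f g *.
move=> ltN fpq grs f0 g0 neq; have d0 : (0 < p + q + (r + s))%N.
  rewrite lt0n; apply: contra_notN neq; rewrite !addn_eq0.
  by move=> /andP[/andP[/eqP-> /eqP->] /andP[/eqP-> /eqP->]].
have /Lam_lap_deg : euler (f * g) = (p + q + (r + s))%:R *: (f * g).
  rewrite eulerM (euler_bidegree fpq) (euler_bidegree grs) [in RHS]natrD [in RHS]scalerDl.
  by rewrite -scalerAl -scalerAr.
rewrite zw_lapM f0 g0 mul0r mulr0 !add0r raddf_sum big1 => [|j _]; last first.
  rewrite raddfD /=; have lap0 k (h : A) : zw_lap h = 0 -> zw_lap (mderiv k h) = 0.
    by move=> h0; rewrite zw_lap_mderiv h0 raddf0.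
  rewrite [X in X + _](_ : _ = 0); last first.
    have [->|[q' eq fq]] := bidegree_dw j fpq; first by rewrite mul0r raddf0.
    have [->|[r' er gr]] := bidegree_dz j grs; first by rewrite mulr0 raddf0.
    apply: (IH _ _ _ _ _ _ _ fq gr); rewrite ?lap0 //; first by lia.
    by move=> [? ?]; apply: neq; subst.
  rewrite add0r.
  have [->|[q' eq fq]] := bidegree_dz j fpq; first by rewrite mul0r raddf0.
  have [->|[r' er gr]] := bidegree_dw j grs; first by rewrite mulr0 raddf0.
  apply: (IH _ _ _ _ _ _ _ fq gr); rewrite ?lap0 //; first by lia.
  by move=> [? ?]; apply: neq; subst.
rewrite mul0rn => /esym/eqP; rewrite mulf_eq0 pnatr_eq0 muln_eq0 => /orP[|/eqP //].
lia.
Qed.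

Lemma mderiv_varX k h c : mderiv k (mpolyX K (mnm1 h) ^+ c : A) =
  (c%:R * (h == k)%:R) *: mpolyX K (mnm1 h) ^+ c.-1.
Proof.
elim: c => [|c IHc]; first by rewrite mul0r scale0r expr0 -mpolyC1 mderivC.
rewrite exprS mderivM mderiv_var IHc; case: eqVneq => _; last first.
  by rewrite !mulr0 !scale0r mulr0 mul0r addr0.
rewrite !mulr1 mul1r -scalerAr -exprS /=; case: c {IHc} => [|c] /=.
  by rewrite scale0r addr0 scale1r.
by rewrite -[X in X + _]scale1r -scalerDl; congr (_ *: _); rewrite -natr1 addrC.
Qed.

Definition zw_mon i a b : A := Z i ^+ a * W i ^+ b.

Lemma zw_monM i a b c e : zw_mon i a b * zw_mon i c e = zw_mon i (a + c) (b + e).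
Proof. by rewrite /zw_mon !exprD; ring. Qed.

Lemma bidegree_zw_mon i a b : bidegree a b (zw_mon i a b).
Proof.
rewrite -[a in bidegree a]addn0 -[b in bidegree _ b]add0n.
by apply: bidegreeM; [exact: bidegree_Zexp|exact: bidegree_Wexp].
Qed.

Lemma mderiv_zw_mon_neq i j a b : j != i ->
  dz j (zw_mon i a b) = 0 /\ dw j (zw_mon i a b) = 0.
Proof.
move=> ji; rewrite !mderivM !mderiv_varX eq_lshift eq_rlshift eq_lrshift eq_rshift.
by rewrite (eq_sym i) (negPf ji) !mulr0 !scale0r !mul0r !mulr0 addr0.
Qed.

Lemma zw_lap_mon i a b :
  zw_lap (zw_mon i a b) = (a * b)%:R *: zw_mon i a.-1 b.-1.
Proof.
rewrite /zw_lap (bigD1 i) //= big1 => [|j ji].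
  rewrite addr0 mderivM !mderiv_varX eqxx eq_rlshift mulr0 scale0r mulr0 addr0 mulr1.
  rewrite -scalerAl linearZ /= mderivM !mderiv_varX eqxx eq_lrshift mulr0 scale0r mul0r.
  by rewrite add0r mulr1 -scalerAr scalerA natrM.
by have [-> _] := mderiv_zw_mon_neq a b ji; rewrite raddf0.
Qed.

Lemma zw_lap_mon2 i k a b c e : i != k ->
  zw_lap (zw_mon i a b * zw_mon k c e) =
  (a * b)%:R *: (zw_mon i a.-1 b.-1 * zw_mon k c e) +
  (c * e)%:R *: (zw_mon i a b * zw_mon k c.-1 e.-1).
Proof.
move=> ik; rewrite zw_lapM !zw_lap_mon -scalerAl -scalerAr big1 ?addr0 // => j _.
have [->|ji] := eqVneq j i.
  by have [-> ->] := mderiv_zw_mon_neq c e ik; rewrite !mulr0 addr0.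
by have [-> ->] := mderiv_zw_mon_neq a b ji; rewrite !mul0r addr0.
Qed.

(** This is n! / (n + m)!. *)
Definition sphere_moment m : K := \prod_(j < m) (j.+1 + n)%:R^-1.

Lemma sphere_moment_gt0 m : 0 < sphere_moment m.
Proof. by apply: prodr_gt0 => j _; rewrite invr_gt0 ltr0n addSn. Qed.

Lemma sphere_momentS m : sphere_moment m = (m.+1 + n)%:R * sphere_moment m.+1.
Proof.
rewrite [in RHS]/sphere_moment big_ord_recr /= mulrC -mulrA mulVf ?mulr1 // pnatr_eq0.
Qed.

(** Lowering a or b by one through [Lam_lap_deg] gives a recursion on a + b; the contributions a *
    a! * b! and b * a! * b! add up to the factor a + b. *)
Lemma Lam_mon2 i k a b : i != k ->
  Lam (zw_mon i a a * zw_mon k b b) = (a`! * b`!)%:R * sphere_moment (a + b).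
Proof.
move=> ik; have [N] := ubnP (a + b); elim: N => // N IH in a b *; rewrite ltnS => leN.
have [/eqP|ab0] := posnP (a + b).
  rewrite addn_eq0 => /andP[/eqP-> /eqP->].
  by rewrite /zw_mon !expr0 !mulr1 Lam1 /sphere_moment big_ord0 mulr1.
have /Lam_lap_deg : euler (zw_mon i a a * zw_mon k b b) =
    (a + b + (a + b))%:R *: (zw_mon i a a * zw_mon k b b).
  by apply: euler_bidegree; apply: bidegreeM; exact: bidegree_zw_mon.
rewrite zw_lap_mon2 // raddfD /= !linearZ /=.
move=> H.
have d0 : ((a + b + (a + b)) * (a + b + (a + b) + n.*2))%:R != 0 :> K.
  by rewrite pnatr_eq0 muln_eq0; lia.
apply: (mulfI d0); rewrite -H.
(* At a = 0 the truncated a.-1 is harmless, as the coefficient vanishes. *)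
have T1 : (a * a)%:R * Lam (zw_mon i a.-1 a.-1 * zw_mon k b b) =
    a%:R * (a`! * b`!)%:R * sphere_moment (a + b).-1.
  case: a leN {H d0 ab0} => [|a] leN; first by rewrite !mul0r.
  by rewrite IH // factS !natrM; ring.
have T2 : (b * b)%:R * Lam (zw_mon i a a * zw_mon k b.-1 b.-1) =
    b%:R * (a`! * b`!)%:R * sphere_moment (a + b).-1.
  case: b leN {H d0 ab0 T1} => [|b] leN; first by rewrite !mul0r.
  by rewrite (addnS a b) /= in leN *; rewrite IH // factS !natrM; ring.
rewrite T1 T2 (sphere_momentS (a + b).-1) prednK // -addnn !natrM !natrD; ring.
Qed.

(** Not an instance of [Lam_mon2]: in dimension 1 there is no second index. *)
Lemma Lam_mon i a : Lam (zw_mon i a a) = a`!%:R * sphere_moment a.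
Proof.
elim: a => [|a IH].
  by rewrite /zw_mon !expr0 mulr1 Lam1 /sphere_moment big_ord0 mulr1.
have /Lam_lap_deg := euler_bidegree (@bidegree_zw_mon i a.+1 a.+1).
rewrite zw_lap_mon /= linearZ /= IH => H.
have d0 : ((a.+1 + a.+1) * (a.+1 + a.+1 + n.*2))%:R != 0 :> K.
  by rewrite pnatr_eq0 muln_eq0; lia.
apply: (mulfI d0); rewrite -H sphere_momentS factS -addnn !natrM !natrD; ring.
Qed.

Definition zw_harmonic (pq : nat * nat) (f : A) := bidegree pq.1 pq.2 f /\ zw_lap f = 0.

(* If x and y belong to a pattern and z is (b, a), this puts (a, b) in the      *)
(* pattern: up to conjugation, h witnesses that the product of H(x) and H(y)    *)
(* has a nonzero component in H(a, b).                                          *)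
Definition triple_nonzero (x y z : nat * nat) :=
  exists f g h, [/\ zw_harmonic x f, zw_harmonic y g, zw_harmonic z h &
                    Lam (f * g * h) <> 0].

(** This turns closure under sums of bidegrees into closure under differences. *)
Lemma triple_nonzero_swap x y z : triple_nonzero x y z -> triple_nonzero z y x.
Proof.
move=> [f [g [h [xf yg zh]]]]; exists h, g, f; split=> //.
by rewrite -mulrA mulrC (mulrC g).
Qed.

Lemma zw_harmonic_mon2 i k p q : i != k ->
  zw_harmonic (p, q) (zw_mon i p 0 * zw_mon k 0 q).
Proof.
move=> ik; split; last by rewrite zw_lap_mon2 // muln0 !scale0r addr0.
rewrite -[X in bidegree X]addn0 -[X in bidegree _ X]add0n.
by apply: bidegreeM; exact: bidegree_zw_mon.
Qed.

(** The third factor is the conjugate of the product of the first two, so the integrand is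
    |z_i|^(2(p+r)) |z_k|^(2(q+s)). *)
Lemma triple_nonzero_top (i k : 'I_n.+1) p q r s : i != k ->
  triple_nonzero (p, q) (r, s) (q + s, p + r)%N.
Proof.
move=> ik; exists (zw_mon i p 0 * zw_mon k 0 q), (zw_mon i r 0 * zw_mon k 0 s).
exists (zw_mon k (q + s) 0 * zw_mon i 0 (p + r)).
split; [exact: zw_harmonic_mon2|exact: zw_harmonic_mon2| |].
  by apply: zw_harmonic_mon2; rewrite eq_sym.
rewrite (_ : _ * _ = zw_mon i (p + r) (p + r) * zw_mon k (q + s) (q + s)); last first.
  by rewrite /zw_mon !expr0 !exprD; ring.
rewrite Lam_mon2 //; apply/eqP/lt0r_neq0/mulr_gt0; last exact: sphere_moment_gt0.
by rewrite ltr0n muln_gt0 !fact_gt0.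
Qed.

(** The second factor, s z_i^r conj(z_i) conj(z_k)^(s-1) - r z_i^(r-1) z_k conj(z_k)^s, is weighted
    so that the two Laplacians cancel. By [Lam_mon2] the integral is a positive multiple of p s - q
    r, which is positive by the two inequalities. *)
Lemma triple_nonzero_subtop (i k : 'I_n.+1) p q r s :
  i != k -> (q < p)%N -> (r < s)%N ->
  triple_nonzero (p, q) (r, s) (q + s.-1, p.-1 + r)%N.
Proof.
move=> ik; case: p => // p qp; case: s => // s rs /=.
pose g1 := zw_mon i r 1 * zw_mon k 0 s; pose g2 := zw_mon i r.-1 0 * zw_mon k 1 s.+1.
exists (zw_mon i p.+1 0 * zw_mon k 0 q), (s.+1%:R *: g1 - r%:R *: g2).
exists (zw_mon k (q + s) 0 * zw_mon i 0 (p + r)).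
split; [exact: zw_harmonic_mon2| |by apply: zw_harmonic_mon2; rewrite eq_sym|].
  split; last first.
    rewrite raddfB /= !linearZ /= /g1 /g2 !zw_lap_mon2 //=.
    rewrite !(mul0n, muln0, muln1, mul1n, scale0r, addr0, add0r).
    by rewrite scalerN !scalerA -!natrM mulnC subrr.
  rewrite -scaleNr; apply: bidegreeD.
    apply: bidegreeZ; rewrite -[X in bidegree X]addn0 -[X in bidegree _ X]add1n.
    by apply: bidegreeM; exact: bidegree_zw_mon.
  (* At r = 0 the truncated r.-1 gives [g2] a wrong bidegree, but its coefficient is 0. *)
  case: {g1 rs} r @g2 => [|r] g2; first by rewrite oppr0 scale0r; exact: bidegree0.
  apply: bidegreeZ; rewrite -[X in bidegree X]addn1 -[X in bidegree _ X]add0n.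
  by apply: bidegreeM; exact: bidegree_zw_mon.
set f := _ * zw_mon k 0 q; set h := zw_mon k _ _ * _.
have e1 : f * g1 * h = zw_mon i (p + r).+1 (p + r).+1 * zw_mon k (q + s) (q + s).
  by rewrite /f /g1 /h /zw_mon !expr0 !exprS !exprD; ring.
have e2 : (r%:R *: f * g2 * h) =
    r%:R *: (zw_mon i (p + r) (p + r) * zw_mon k (q + s).+1 (q + s).+1).
  rewrite -!scalerAl /h /g2; case: (r) => [|r']; first by rewrite !scale0r.
  by rewrite /f /zw_mon !expr0 (addnS p r') !exprS !exprD /=; congr (_ *: _); ring.
have -> : f * (s.+1%:R *: g1 - r%:R *: g2) * h =
    s.+1%:R *: (f * g1 * h) - r%:R *: f * g2 * h.
  by rewrite mulrBr mulrBl -!scalerAr -!scalerAl.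
have LamZ c u : Lam (c *: u) = c * Lam u by exact: linearZ.
rewrite e1 e2 (raddfB Lam) /= !LamZ !Lam_mon2 // (addSnnS (p + r)) !factS.
set M := sphere_moment _; have M0 : 0 < M := sphere_moment_gt0 _.
rewrite (_ : _ - _ = (s.+1%:R * p.+1%:R - r%:R * q%:R) *
                     ((p + r)`! * (q + s)`!)%:R * M).
  apply/eqP/lt0r_neq0; rewrite !mulr_gt0 // ?ltr0n ?muln_gt0 ?fact_gt0 //.
  by rewrite subr_gt0 -!natrM ltr_nat ltn_mul.
by rewrite !natrM -!natr1 !natrD; ring.
Qed.

Lemma triple_nonzero_Z a b : triple_nonzero (a, 0) (b, 0) (0, a + b)%N.
Proof.
exists (zw_mon ord0 a 0), (zw_mon ord0 b 0), (zw_mon ord0 0 (a + b)).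
split; do ?by split;
  [exact: bidegree_zw_mon|rewrite zw_lap_mon ?muln0 ?mul0n scale0r].
rewrite !zw_monM add0n addn0 Lam_mon; apply/eqP/lt0r_neq0/mulr_gt0.
  by rewrite ltr0n fact_gt0.
exact: sphere_moment_gt0.
Qed.

Lemma triple_nonzero_W a b : triple_nonzero (0, a) (0, b) (a + b, 0)%N.
Proof.
exists (zw_mon ord0 0 a), (zw_mon ord0 0 b), (zw_mon ord0 (a + b) 0).
split; do ?by split;
  [exact: bidegree_zw_mon|rewrite zw_lap_mon ?muln0 ?mul0n scale0r].
rewrite !zw_monM add0n addn0 Lam_mon; apply/eqP/lt0r_neq0/mulr_gt0.
  by rewrite ltr0n fact_gt0.
exact: sphere_moment_gt0.
Qed.

End Bidegree.

(** * Substituting z = x + i y and its conjugate *)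

Section ComplexCoordinates.
Variables (n : nat) (K : numFieldType) (im : K).
Hypothesis im_sq : im * im = -1.
Local Notation A := (mpoly (n.+1 + n.+1) K).
Local Notation X k := (mpolyX K (mnm1 k) : A).
Local Notation Z i := (mpolyX K (mnm1 (lshift n.+1 i)) : A).
Local Notation W i := (mpolyX K (mnm1 (rshift n.+1 i)) : A).
Local Notation dl i := (@mderiv (n.+1 + n.+1) K (lshift n.+1 i)).
Local Notation dr i := (@mderiv (n.+1 + n.+1) K (rshift n.+1 i)).

(** [zzbar] with an arbitrary square root of -1 in place of 'i. *)
Definition zw_coord (k : 'I_(n.+1 + n.+1)) : A :=
  match fintype.split k with
  | inl j => Z j + im *: W j
  | inr j => Z j - im *: W j
  end.

Definition of_zw (f : A) : A := comp_mpoly [tuple zw_coord k | k < n.+1 + n.+1] f.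

Lemma of_zw_is_linear : linear of_zw.
Proof. by move=> c f g; rewrite /of_zw comp_mpolyD comp_mpolyZ. Qed.
HB.instance Definition _ := GRing.isLinear.Build K A A _ of_zw of_zw_is_linear.

Lemma of_zwD f g : of_zw (f + g) = of_zw f + of_zw g.
Proof. exact: comp_mpolyD. Qed.

Lemma of_zwM f g : of_zw (f * g) = of_zw f * of_zw g.
Proof. exact: rmorphM. Qed.

Lemma of_zw1 : of_zw 1 = 1.
Proof. exact: rmorph1. Qed.

Lemma zw_coordl i : zw_coord (lshift n.+1 i) = Z i + im *: W i.
Proof. by rewrite /zw_coord -[lshift _ _]/(unsplit (inl i)) unsplitK. Qed.

Lemma zw_coordr i : zw_coord (rshift n.+1 i) = Z i - im *: W i.
Proof. by rewrite /zw_coord -[rshift _ _]/(unsplit (inr i)) unsplitK. Qed.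

Lemma of_zw_Z i : of_zw (Z i) = Z i + im *: W i.
Proof. by rewrite /of_zw comp_mpolyXU -tnth_nth tnth_mktuple zw_coordl. Qed.

Lemma of_zw_W i : of_zw (W i) = Z i - im *: W i.
Proof. by rewrite /of_zw comp_mpolyXU -tnth_nth tnth_mktuple zw_coordr. Qed.

Lemma dl_of_zw i f : dl i (of_zw f) = of_zw (dl i f) + of_zw (dr i f).
Proof.
rewrite /of_zw mderiv_comp_mpoly big_split_ord /=; congr (_ + _).
  rewrite (bigD1 i) //= big1 => [|j ji].
    rewrite tnth_mktuple zw_coordl mderivD mderivZ !mderiv_var eqxx eq_rlshift.
    by rewrite scaler0 !addr0 mulr1.
  rewrite tnth_mktuple zw_coordl mderivD mderivZ !mderiv_var eq_lshift eq_rlshift.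
  by rewrite (negPf ji) scaler0 addr0 mulr0.
rewrite (bigD1 i) //= big1 => [|j ji].
  rewrite tnth_mktuple zw_coordr mderivB mderivZ !mderiv_var eqxx eq_rlshift.
  by rewrite scaler0 subr0 !addr0 mulr1.
rewrite tnth_mktuple zw_coordr mderivB mderivZ !mderiv_var eq_lshift eq_rlshift.
by rewrite (negPf ji) scaler0 subr0 mulr0.
Qed.

Lemma dr_of_zw i f : dr i (of_zw f) = im *: (of_zw (dl i f) - of_zw (dr i f)).
Proof.
rewrite scalerBr /of_zw mderiv_comp_mpoly big_split_ord /=; congr (_ + _).
  rewrite (bigD1 i) //= big1 => [|j ji].
    rewrite tnth_mktuple zw_coordl mderivD mderivZ !mderiv_var eqxx eq_lrshift.
    by rewrite add0r addr0 -scalerAr mulr1.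
  rewrite tnth_mktuple zw_coordl mderivD mderivZ !mderiv_var eq_lrshift eq_rshift.
  by rewrite (negPf ji) scaler0 addr0 mulr0.
rewrite (bigD1 i) //= big1 => [|j ji].
  rewrite tnth_mktuple zw_coordr mderivB mderivZ !mderiv_var eqxx eq_lrshift.
  by rewrite sub0r addr0 mulrN -scalerAr mulr1.
rewrite tnth_mktuple zw_coordr mderivB mderivZ !mderiv_var eq_lrshift eq_rshift.
by rewrite (negPf ji) scaler0 subr0 mulr0.
Qed.

Lemma lap_ring_identity (B : comRingType) (a b c : B) :
  a + b + (b + c) + - (a - b - (b - c)) = b *+ 4.
Proof. by ring. Qed.

(** With a and b the derivatives in z and conj z, those in x and y are a + b and i (a - b); their
    squares add up to 4 a b. *)
Lemma lap_of_zw f : lap (of_zw f) = of_zw (zw_lap f) *+ 4.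
Proof.
rewrite /lap /zw_lap raddf_sum -sumrMnl big_split_ord /= -big_split /=.
apply: eq_bigr => j _; move: (@dl_of_zw j) (@dr_of_zw j).
move: of_zw => F Fl Fr; rewrite !Fl !Fr mderivD mderivZ mderivB !Fl !Fr.
rewrite -scalerBr scalerA im_sq scaleN1r (mderiv_comm (lshift _ j) _ f).
exact: (@lap_ring_identity A).
Qed.

Lemma euler_of_zw f : euler (of_zw f) = of_zw (euler f).
Proof.
rewrite /euler raddf_sum /= !big_split_ord /= -!big_split /=; apply: eq_bigr => j _.
rewrite !of_zwM of_zw_Z of_zw_W; move: (@dl_of_zw j f) (@dr_of_zw j f).
move: of_zw => F -> ->; rewrite -!mul_mpolyC.
have : (mpolyC _ im * mpolyC _ im : A) = -1 by rewrite -mpolyCM im_sq mpolyCN mpolyC1.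
move: (mpolyC _ _) => c c2.
ring: c2.
Qed.

(** Needed to pull harmonicity back from x, y to z, conj z. The inverse substitution [back] is x =
    (z + w) / 2, y = - (i / 2) (z - w), with w for conj z. *)
Lemma of_zw_inj : injective of_zw.
Proof.
pose back k : A := match fintype.split k with
  | inl j => 2^-1 *: (Z j + W j) | inr j => - (2^-1 * im) *: (Z j - W j) end.
have i2 : 2^-1 + 2^-1 = 1 :> K.
  by rewrite -mulr2n -[LHS]mulr_natr mulVf // pnatr_eq0.
have [B [BC BD BM BZ]] : exists B : A -> A,
    [/\ forall c, B (mpolyC _ c) = mpolyC _ c, {morph B : f g / f + g},
        {morph B : f g / f * g} & forall k, B (X k) = back k].
  exists (comp_mpoly [tuple back k | k < n.+1 + n.+1]).
  split=> [c|f g|f g|k]; [exact: comp_mpolyC|exact: comp_mpolyD|exact: rmorphM|].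
  by rewrite comp_mpolyXU -tnth_nth tnth_mktuple.
have BS c f : B (c *: f) = c *: B f by rewrite -!mul_mpolyC BM BC.
have bZ j : B (Z j) = 2^-1 *: (Z j + W j).
  by rewrite BZ /back -[lshift _ _]/(unsplit (inl j)) unsplitK.
have bW j : B (W j) = - (2^-1 * im) *: (Z j - W j).
  by rewrite BZ /back -[rshift _ _]/(unsplit (inr j)) unsplitK.
apply: (can_inj (g := B)); elim/mpoly_ring_ind => [c|k|f g IHf IHg|f g IHf IHg].
- by rewrite /of_zw comp_mpolyC BC.
- rewrite -[k]splitK; case: (fintype.split k) => j /=.
    rewrite of_zw_Z BD BS bZ bW scalerA mulrN mulrCA im_sq.
    rewrite mulrN1 opprK scalerDr scalerBr addrACA subrr addr0 -scalerDl i2.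
    by rewrite scale1r.
  rewrite of_zw_W -scaleNr BD BS bZ bW scalerA mulrNN mulrCA im_sq.
  rewrite mulrN1 scaleNr -scalerBr opprB addrC addrA subrK scalerDr -scalerDl i2.
  by rewrite scale1r.
- by rewrite of_zwD BD IHf IHg.
- by rewrite of_zwM BM IHf IHg.
Qed.

End ComplexCoordinates.

(** * Integration over the sphere *)

Section BoundedMeasurable.
Variables (R : realType) (n : nat).
Variable sigma : probability (borel_sphere R n) R.
Local Notation T := (borel_sphere R n).
Local Notation N := (n.+1 + n.+1)%N.

(** A class closed under ring operations and rotations and contained in both L^1 and L^oo, which
    settles all integrability conditions at once. *)
Definition bounded_measurable (f : T -> R) : Prop :=
  measurable_fun setT f /\ exists M : R, forall x, `|f x| <= M.

Lemma bounded_measurable_cst c : bounded_measurable (fun=> c).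
Proof. by split; [exact: measurable_cst | exists `|c|]. Qed.

Lemma bounded_measurableD f g : bounded_measurable f -> bounded_measurable g ->
  bounded_measurable (fun x => f x + g x).
Proof.
move=> [mf [M fM]] [mg [M' gM]]; split; first exact: measurable_funD.
by exists (M + M') => x; rewrite (le_trans (ler_normD _ _)) ?lerD.
Qed.

Lemma bounded_measurableM f g : bounded_measurable f -> bounded_measurable g ->
  bounded_measurable (fun x => f x * g x).
Proof.
move=> [mf [M fM]] [mg [M' gM]]; split; first exact: measurable_funM.
by exists (M * M') => x; rewrite normrM ler_pM.
Qed.

Lemma bounded_measurableB f g : bounded_measurable f -> bounded_measurable g ->
  bounded_measurable (fun x => f x - g x).
Proof.
move=> [mf [M fM]] [mg [M' gM]]; split; first exact: measurable_funB.
by exists (M + M') => x; rewrite (le_trans (ler_normB _ _)) ?lerD.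
Qed.

Lemma bounded_measurable_integrable f : bounded_measurable f ->
  sigma.-integrable setT (EFin \o f).
Proof.
move=> [mf [M fM]]; apply: measurable_bounded_integrable => //.
  by apply: (@le_lt_trans _ _ 1%E); [exact: probability_le1|exact: ltry].
exists M; split; first exact: num_real.
by move=> y My x _ /=; exact: le_trans (fM x) (ltW My).
Qed.

Lemma bounded_measurable_Lfun1 f : bounded_measurable f -> f \in Lfun sigma 1.
Proof. by move=> bf; apply/Lfun1_integrable/bounded_measurable_integrable. Qed.

Lemma bounded_measurable_Lfuny f : bounded_measurable f -> f \in Lfun sigma +oo%E.
Proof.
move=> [mf [M fM]]; rewrite inE; apply/andP; split; rewrite inE //=.
rewrite /finite_norm unlock; case: ifPn => [_|_]; last by rewrite ltry.
apply: (@le_lt_trans _ _ M%:E); last by rewrite ltry.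
by apply: ereal_inf_lbound => /=; apply: aeW => x /=; rewrite lee_fin.
Qed.

Lemma open_measurable_sphere (A : set (sphere R n)) : open A -> measurable (A : set T).
Proof. by move=> oA; apply: sub_sigma_algebra. Qed.

Lemma continuous_measurable_sphere (f : sphere R n -> R) :
  continuous f -> measurable_fun setT (f : T -> R).
Proof.
move=> /continuousP cf; apply: (measurability _ (RGenOpens.measurableE R)).
move=> _ [_ [a [b ->] <-]]; rewrite setTI; apply: open_measurable_sphere.
exact/cf/interval_open.
Qed.

Lemma sphere_coord_continuous k : continuous (fun x : sphere R n => val x 0 k).
Proof.
move=> x; apply: (@continuous_comp _ _ _ (@set_val _ _) (fun y : 'rV[R]_N => y 0 k)).
  exact: initial_continuous.
exact: coord_continuous.
Qed.

Lemma bounded_measurable_coord k : bounded_measurable (fun x => val x 0 k).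
Proof.
split; first by apply: continuous_measurable_sphere; exact: sphere_coord_continuous.
exists 1 => x; rewrite -(ler_pXn2r (n := 2)) ?nnegrE // expr1n real_normK ?num_real //.
have /set_mem <- := valP x; rewrite (bigD1 k) //= lerDl.
by apply: sumr_ge0 => j _; exact: sqr_ge0.
Qed.

Lemma sphere_linear_continuous (s : seq 'I_N) (c : 'I_N -> R) :
  continuous (fun x : sphere R n => \sum_(j <- s) val x 0 j * c j).
Proof.
elim: s => [|j s IHs].
  have -> : (fun x : sphere R n => \sum_(j <- [::]) val x 0 j * c j) = fun=> 0.
    by apply/funext => y; rewrite big_nil.
  exact: cst_continuous.
have -> : (fun x : sphere R n => \sum_(i <- j :: s) val x 0 i * c i) =
    fun x => val x 0 j * c j + \sum_(i <- s) val x 0 i * c i.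
  by apply/funext => y; rewrite big_cons.
move=> x; have FF : Filter (nbhs x) := nbhs_filter x.
have cj := cvgM (@sphere_coord_continuous j x) (cvg_cst (c j)).
exact: cvgD (cj FF FF) (IHs x).
Qed.

Lemma sphere_rot_measurable (U : 'M[R]_N) (UU : U *m U^T = 1%:M) :
  measurable_fun setT (sphere_rot UU : T -> T).
Proof.
have /continuousP cU : continuous (sphere_rot UU : sphere R n -> sphere R n).
  apply: continuous_comp_initial => x B [P PB sPB].
  (* Neighborhoods of a row vector are given entrywise by [P], so each coordinate of the rotated
     point is treated alone. *)
  have: forall k, nbhs x [set y : sphere R n | P 0 k ((val y *m U) 0 k)].
    move=> k; have: {for x, continuous (fun y : sphere R n => (val y *m U) 0 k)}.
      have -> : (fun y : sphere R n => (val y *m U) 0 k) =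
          fun y : sphere R n => \sum_j val y 0 j * U j k.
        by apply/funext => y; rewrite mxE.
      exact: sphere_linear_continuous.
    by apply; exact: PB.
  move=> H; have := filter_forall (nbhs_filter x) H.
  apply: filterS => y Py; apply: sPB => i j.
  by rewrite (ord1 i); exact: Py.
apply: (@measurability _ _ T T setT _ (@open (sphere R n))) => // _ [A oA <-].
by rewrite setTI; apply: open_measurable_sphere; exact: cU.
Qed.

Lemma bounded_measurable_sphere_rot (U : 'M[R]_N) (UU : U *m U^T = 1%:M) f :
  bounded_measurable f -> bounded_measurable (fun x => f (sphere_rot UU x)).
Proof.
move=> [mf [M fM]]; split; last by exists M.
exact: (measurableT_comp mf (sphere_rot_measurable UU)).
Qed.

Hypothesis sigma_rot : rotation_invariant sigma.

Lemma Rintegral_sphere_rot (U : 'M[R]_N) (UU : U *m U^T = 1%:M) f :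
  bounded_measurable f ->
  \int[sigma]_x f (sphere_rot UU x) = \int[sigma]_x f x.
Proof.
move=> bf; rewrite /Rintegral; congr fine.
have mU := sphere_rot_measurable UU.
have mf : measurable_fun setT (EFin \o f) by case: bf => /measurable_EFinP.
have intf := bounded_measurable_integrable (bounded_measurable_sphere_rot UU bf).
have := integral_pushforward mU mf intf measurableT; rewrite preimage_setT => <-.
by apply: eq_measure_integral => A mA _; exact: sigma_rot.
Qed.

End BoundedMeasurable.

(** * Rationally parametrized plane rotations *)

Section PlaneRotation.
Variables (R : realFieldType) (N : nat) (j k : 'I_N) (t : R).
Hypothesis jk : j != k.

Definition rot_cos := (1 - t ^+ 2) / (1 + t ^+ 2).
Definition rot_sin := (t *+ 2) / (1 + t ^+ 2).

Definition plane_rot : 'M[R]_N :=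
  1%:M + ((rot_cos - 1) *: (delta_mx j j + delta_mx k k) +
          rot_sin *: (delta_mx j k - delta_mx k j)).

Lemma plane_rot_den : 1 + t ^+ 2 != 0.
Proof. by rewrite lt0r_neq0 // ltr_wpDr // sqr_ge0. Qed.

(** With P the projection onto the plane and J its quarter turn, the rotation is 1 + (c - 1) P + s
    J. Orthogonality then follows from the products of P and J and from c^2 + s^2 = 1. *)
Lemma plane_rot_orthogonal : plane_rot *m plane_rot^T = 1%:M.
Proof.
have kj : (k == j) = false by rewrite eq_sym (negPf jk).
pose P : 'M[R]_N := delta_mx j j + delta_mx k k.
pose J : 'M[R]_N := delta_mx j k - delta_mx k j.
have PP : P *m P = P.
  rewrite mulmxDl !mulmxDr !mul_delta_mx_cond !eqxx (negPf jk) kj !mulr1n !mulr0n.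
  by rewrite addr0 add0r.
have PJ : P *m J = J.
  rewrite mulmxDl !mulmxBr !mul_delta_mx_cond !eqxx (negPf jk) kj !mulr1n !mulr0n.
  by rewrite subr0 sub0r.
have JP : J *m P = J.
  rewrite mulmxBl !mulmxDr !mul_delta_mx_cond !eqxx (negPf jk) kj !mulr1n !mulr0n.
  by rewrite add0r addr0.
have JJ : J *m J = - P.
  rewrite mulmxBl !mulmxBr !mul_delta_mx_cond !eqxx (negPf jk) kj !mulr1n !mulr0n.
  by rewrite sub0r subr0 opprD.
have -> : plane_rot^T = 1%:M + ((rot_cos - 1) *: P - rot_sin *: J).
  rewrite /plane_rot linearD /= trmx1 linearD /= !linearZ /= linearD linearB /=.
  rewrite !trmx_delta.
  by rewrite -/P -[delta_mx k j - _]opprB -/J scalerN.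
rewrite /plane_rot -/P -/J mulmxDl mul1mx mulmxDr mulmx1 mulmxDl !mulmxBr.
rewrite -!scalemxAl -!scalemxAr PP PJ JP JJ.
have cs : rot_cos ^+ 2 + rot_sin ^+ 2 = 1.
  by rewrite /rot_cos /rot_sin; field; exact: plane_rot_den.
clearbody P J; apply/matrixP => a b; rewrite !mxE.
move: (P a b) (J a b) ((a == b)%:R : R) => p q d.
move: rot_cos rot_sin cs => c s cs.
transitivity (d + (c ^+ 2 + s ^+ 2 - 1) * p); last by rewrite cs subrr mul0r addr0.
ring.
Qed.

(** The right-hand sides are the entries of [scaled_rot] evaluated at t and x. *)
Lemma mulmx_plane_rot (x : 'rV[R]_N) i :
  (1 + t ^+ 2) * (x *m plane_rot) 0 i =
  if i == k then (1 - t ^+ 2) * x 0 k + t *+ 2 * x 0 j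
  else if i == j then (1 - t ^+ 2) * x 0 j - t *+ 2 * x 0 k
  else (1 + t ^+ 2) * x 0 i.
Proof.
have xd a b : (x *m delta_mx a b) 0 i = x 0 a * (i == b)%:R.
  rewrite mxE (bigD1 a) //= big1 => [|c ca]; first by rewrite mxE eqxx addr0.
  by rewrite mxE (negPf ca) mulr0.
have kj : (k == j) = false by rewrite eq_sym (negPf jk).
rewrite /plane_rot mulmxDr mulmx1 mulmxDr -!scalemxAr mulmxDr mulmxBr.
have mxD (A B : 'rV[R]_N) : (A + B) 0 i = A 0 i + B 0 i by rewrite mxE.
have mxN (A : 'rV[R]_N) : (- A) 0 i = - A 0 i by rewrite mxE.
have mxZ c (A : 'rV[R]_N) : (c *: A) 0 i = c * A 0 i by rewrite mxE.
rewrite !(mxD, mxN, mxZ, xd).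
have d0 := plane_rot_den; rewrite /rot_cos /rot_sin.
have [->|ik] := eqVneq i k; first by rewrite kj /=; field.
by have [->|ij] := eqVneq i j; rewrite /=; field.
Qed.

End PlaneRotation.

(** * The integral as an invariant functional on polynomials *)

Section PolynomialIntegral.
Local Open Scope complex_scope.
Variables (R : realType) (n : nat).
Variable sigma : probability (borel_sphere R n) R.
Local Notation T := (borel_sphere R n).
Local Notation N := (n.+1 + n.+1)%N.
Local Notation A := (mpoly N R[i]).
Local Notation X k := (mpolyX R[i] (mnm1 k) : A).

Definition Cbounded_measurable (f : T -> R[i]) : Prop :=
  bounded_measurable (fun x => complex.Re (f x)) /\
  bounded_measurable (fun x => complex.Im (f x)).

Lemma ReD (a b : R[i]) : complex.Re (a + b) = complex.Re a + complex.Re b.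
Proof. by case: a b => [? ?] [? ?]. Qed.

Lemma ImD (a b : R[i]) : complex.Im (a + b) = complex.Im a + complex.Im b.
Proof. by case: a b => [? ?] [? ?]. Qed.

Lemma ReM (a b : R[i]) :
  complex.Re (a * b) = complex.Re a * complex.Re b - complex.Im a * complex.Im b.
Proof. by case: a b => [? ?] [? ?]. Qed.

Lemma ImM (a b : R[i]) :
  complex.Im (a * b) = complex.Re a * complex.Im b + complex.Im a * complex.Re b.
Proof. by case: a b => [? ?] [? ?]. Qed.

Lemma Cbounded_measurable_cst c : Cbounded_measurable (fun=> c).
Proof. by split; exact: bounded_measurable_cst. Qed.

Lemma Cbounded_measurableD f g : Cbounded_measurable f -> Cbounded_measurable g ->
  Cbounded_measurable (fun x => f x + g x).
Proof.
move=> [f1 f2] [g1 g2]; split.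
  by under eq_fun do rewrite ReD; exact: bounded_measurableD.
by under eq_fun do rewrite ImD; exact: bounded_measurableD.
Qed.

Lemma Cbounded_measurableM f g : Cbounded_measurable f -> Cbounded_measurable g ->
  Cbounded_measurable (fun x => f x * g x).
Proof.
move=> [f1 f2] [g1 g2]; split.
  by under eq_fun do rewrite ReM; apply: bounded_measurableB; exact: bounded_measurableM.
by under eq_fun do rewrite ImM; apply: bounded_measurableD; exact: bounded_measurableM.
Qed.

Lemma restrD (P Q : A) :
  restr (P + Q) = (fun x => restr P x + restr Q x) :> (T -> R[i]).
Proof. by apply/funext => x; rewrite /restr mevalD. Qed.

Lemma restrM (P Q : A) :
  restr (P * Q) = (fun x => restr P x * restr Q x) :> (T -> R[i]).
Proof. by apply/funext => x; rewrite /restr mevalM. Qed.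

Lemma restrZ c (P : A) : restr (c *: P) = (fun x => c * restr P x) :> (T -> R[i]).
Proof. by apply/funext => x; rewrite /restr mevalZ. Qed.

Lemma restr1 : restr (1 : A) = (fun=> 1) :> (T -> R[i]).
Proof. by apply/funext => x; rewrite /restr meval1. Qed.

Lemma Cbounded_measurable_restr (P : A) : Cbounded_measurable (restr P).
Proof.
elim/mpoly_ring_ind: P => [c|k|p q IHp IHq|p q IHp IHq].
- rewrite (_ : restr _ = fun=> c); first exact: Cbounded_measurable_cst.
  by apply/funext => x; rewrite /restr mevalC.
- rewrite (_ : restr _ = fun x => (val x 0 k)%:C).
    by split; [exact: bounded_measurable_coord | exact: bounded_measurable_cst].
  by apply/funext => x; rewrite /restr mevalXU.
- by rewrite restrD; exact: Cbounded_measurableD.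
- by rewrite restrM; exact: Cbounded_measurableM.
Qed.

Lemma Cbounded_measurable_LC1 f : Cbounded_measurable f -> LC sigma 1%E f.
Proof. by move=> [f1 f2]; split; exact: bounded_measurable_Lfun1. Qed.

Lemma Cbounded_measurable_LCy f : Cbounded_measurable f -> LC sigma +oo%E f.
Proof. by move=> [f1 f2]; split; exact: bounded_measurable_Lfuny. Qed.

Lemma CintegralD f g : Cbounded_measurable f -> Cbounded_measurable g ->
  Cintegral sigma (fun x => f x + g x) = Cintegral sigma f + Cintegral sigma g.
Proof.
move=> [f1 f2] [g1 g2]; rewrite /Cintegral.
have -> : \int[sigma]_x complex.Re (f x + g x) =
    \int[sigma]_x (complex.Re (f x) + complex.Re (g x)).
  by apply: eq_Rintegral => x _; rewrite ReD.
have -> : \int[sigma]_x complex.Im (f x + g x) =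
    \int[sigma]_x (complex.Im (f x) + complex.Im (g x)).
  by apply: eq_Rintegral => x _; rewrite ImD.
by rewrite !RintegralD //; exact: bounded_measurable_integrable.
Qed.

Lemma CintegralZ c f : Cbounded_measurable f ->
  Cintegral sigma (fun x => c * f x) = c * Cintegral sigma f.
Proof.
have iM a g : bounded_measurable g ->
    sigma.-integrable setT (EFin \o (fun x => a * g x)).
  move=> bg; apply: bounded_measurable_integrable.
  by apply: bounded_measurableM => //; exact: bounded_measurable_cst.
move=> [f1 f2]; rewrite /Cintegral.
have -> : \int[sigma]_x complex.Re (c * f x) =
    \int[sigma]_x (complex.Re c * complex.Re (f x) - complex.Im c * complex.Im (f x)).
  by apply: eq_Rintegral => x _; rewrite ReM.
have -> : \int[sigma]_x complex.Im (c * f x) =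
    \int[sigma]_x (complex.Re c * complex.Im (f x) + complex.Im c * complex.Re (f x)).
  by apply: eq_Rintegral => x _; rewrite ImM.
rewrite RintegralB ?RintegralD ?RintegralZl //;
  try exact: iM; try exact: bounded_measurable_integrable.
by case: c.
Qed.

Definition sphere_integral (P : A) : R[i] := Cintegral sigma (restr P).

Lemma sphere_integral_is_scalar : scalar sphere_integral.
Proof.
move=> c P Q; rewrite /sphere_integral restrD restrZ CintegralD ?CintegralZ //.
- exact: Cbounded_measurable_restr.
- apply: Cbounded_measurableM; first exact: Cbounded_measurable_cst.
  exact: Cbounded_measurable_restr.
- exact: Cbounded_measurable_restr.
Qed.

Lemma sphere_integral1 : sphere_integral 1 = 1.
Proof.
rewrite /sphere_integral restr1 /Cintegral /= !Rintegral_cst // mul0r.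
have s1 : sigma [set: T] = 1%E by exact: probability_setT.
by congr Complex; rewrite mul1r; exact: (congr1 fine s1).
Qed.

Lemma sphere_integral_norm P :
  sphere_integral ((\sum_j X j ^+ 2) * P) = sphere_integral P.
Proof.
congr Cintegral; apply/funext => x; rewrite /restr mevalM rmorph_sum /=.
rewrite (eq_bigr (fun j => (val x 0 j ^+ 2)%:C)) => [|j _].
  by rewrite -rmorph_sum /=; have /set_mem -> := valP x; rewrite mul1r.
by rewrite !rmorphXn /= mevalXU.
Qed.

Hypothesis sigma_rot : rotation_invariant sigma.

Lemma Cintegral_sphere_rot (U : 'M[R]_N) (UU : U *m U^T = 1%:M) f :
  Cbounded_measurable f ->
  Cintegral sigma (fun x => f (sphere_rot UU x)) = Cintegral sigma f.
Proof.
move=> [f1 f2]; rewrite /Cintegral.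
by rewrite (Rintegral_sphere_rot sigma_rot UU f1) (Rintegral_sphere_rot sigma_rot UU f2).
Qed.

(** At x, the substituted monomial is the monomial at (1 + t^2) times the rotated point. Homogeneity
    extracts the power of 1 + t^2, and invariance of [sigma] removes the rotation. *)
Lemma sphere_integral_scaled_rotate j k t m : j != k ->
  sphere_integral (scaled_rotate j k (mpolyX R[i] m)).[t%:R] =
  (1 + t%:R ^+ 2) ^+ mdeg m * sphere_integral (mpolyX R[i] m).
Proof.
move=> jk; rewrite /sphere_integral.
have UU := plane_rot_orthogonal (t%:R : R) jk.
have bm := Cbounded_measurable_restr (mpolyX R[i] m).
rewrite -(Cintegral_sphere_rot UU bm) -CintegralZ; last first.
  by case: bm => b1 b2; split;
    [exact: (bounded_measurable_sphere_rot UU b1)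
    |exact: (bounded_measurable_sphere_rot UU b2)].
congr Cintegral; apply/funext => x.
rewrite /restr /scaled_rotate mmapX /mmap1 horner_prod rmorph_prod /=.
rewrite mevalX mdegE -prodrXr -big_split /=.
apply: eq_bigr => i _.
rewrite -exprMn horner_exp rmorphXn; congr (_ ^+ _).
have -> : (1 + t%:R ^+ 2 : R[i]) = (1 + t%:R ^+ 2)%:C.
  by rewrite rmorphD rmorph1 rmorphXn rmorph_nat.
rewrite -rmorphM mulmx_plane_rot // /scaled_rot; set v := fun k0 => _.
have vX l : meval v (X l) = (val x 0 l)%:C by rewrite mevalXU.
have hE := (hornerD, hornerM, hornerC, hornerN, hornerX, hornerXn).
have mE := (mevalD, mevalN, mevalM, mevalMn, meval1).
have rE := (rmorphD, rmorphN, rmorphM, rmorphXn, rmorph1, rmorph_nat, rmorphMn).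
have [_|_] := eqVneq i k.
  by rewrite !hE -[LHS]/(meval v _) !mE !vX !rE; ring.
have [_|_] := eqVneq i j.
  rewrite !hE -[LHS]/(meval v _) !mE !vX !rE; ring.
by rewrite !hE -[LHS]/(meval v _) !mE !vX !rE; ring.
Qed.

End PolynomialIntegral.

(** * Weak*-closures and annihilators *)

Section WeakStarClosure.
Local Open Scope complex_scope.
Variables (R : realType) (n : nat).
Variable sigma : probability (borel_sphere R n) R.
Local Notation T := (borel_sphere R n).

Lemma subset_weakstar_closure (S : set (T -> R[i])) f :
  S f -> LC sigma +oo%E f -> weakstar_closure sigma S f.
Proof.
move=> Sf Lf; exists (exist _ f (mem_set Lf)) => //.
exact: subset_closure.
Qed.

(** Integration against h in L^1 is weak*-continuous: if it were nonzero at a point of the closure,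
    it would be nonzero somewhere on S. *)
Lemma weakstar_closure_integral0 (S : set (T -> R[i])) f h :
  LC sigma 1%E h ->
  (forall e, S e -> Cintegral sigma (fun x => e x * h x) = 0) ->
  weakstar_closure sigma S f -> Cintegral sigma (fun x => f x * h x) = 0.
Proof.
move=> Lh S0 [g clg <-]; apply: contrapT => /eqP gh0.
pose hh : LC sigma 1%E := exist _ h (mem_set Lh).
have cpair : continuous
    (pairing (sigma := sigma) : initial_topology (pairing (sigma := sigma)) -> _).
  exact: initial_continuous.
have ceval : continuous (fun F : {ptws LC sigma 1%E -> R[i]^o} => F hh).
  exact: (@proj_continuous _ (fun _ => R[i]^o) hh).
have nz : nbhs (pairing g hh : R[i]^o) [set z | z != 0].
  apply/nbhs_ballP; exists `|pairing g hh : R[i]^o|; first by rewrite /= normr_gt0.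
  move=> z; rewrite -ball_normE /= => lt; apply: contraTneq lt => ->.
  by rewrite subr0 ltxx.
have := cpair g _ (ceval (pairing g) _ nz).
by move=> /clg[u [Su]] /=; rewrite /pairing /= S0 ?eqxx.
Qed.

End WeakStarClosure.

(** * The sphere integral as the functional [Lam] *)

Section Functional.
Local Open Scope complex_scope.
Variables (R : realType) (n : nat).
Variable sigma : probability (borel_sphere R n) R.
Local Notation K := (R[i] : numFieldType).
Local Notation A := (mpoly (n.+1 + n.+1) K).

HB.instance Definition _ := GRing.isLinear.Build K A K *%R (sphere_integral sigma)
  (sphere_integral_is_scalar sigma).

Definition zw_integral : {scalar A} := sphere_integral sigma \o of_zw ('i : K).

Lemma harmonic_space_zw p q h : harmonic_space p q h <->
  exists2 f : A, zw_harmonic (p, q) f & h = @restr R n (of_zw ('i : K) f).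
Proof.
have i2 : ('i : K) * 'i = -1 by rewrite -expr2 sqr_i.
split=> [[P [[f [fpq ->]] lap0] <-]|[f [fpq lap0] ->]].
  exists f => //; split=> //; apply: (of_zw_inj i2); rewrite raddf0; apply/eqP.
  have : lap (of_zw ('i : K) f) = 0 := lap0.
  by rewrite lap_of_zw // -scaler_nat => /eqP; rewrite scaler_eq0 pnatr_eq0.
exists (of_zw ('i : K) f) => //; split; first by exists f; split.
by have := lap_of_zw i2 f; rewrite lap0 raddf0 mul0rn.
Qed.

Hypothesis sigma_rot : rotation_invariant sigma.

Lemma zw_integral1 : zw_integral 1 = 1.
Proof. by rewrite /zw_integral /= of_zw1 sphere_integral1. Qed.

Lemma zw_integral_lap (f : A) :
  zw_integral (zw_lap f) *+ 4 + zw_integral (euler f) *+ 2 =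
  zw_integral (euler (euler f)) + zw_integral (euler f) *+ (n.+1 + n.+1).
Proof.
have i2 : ('i : K) * 'i = -1 by rewrite -expr2 sqr_i.
have Lrot j k (q : A) : j != k -> sphere_integral sigma (rot_gen j k q) = 0.
  move=> jk; apply: (scalar_rot_gen (Lam := sphere_integral sigma) q jk) => t m.
  exact: sphere_integral_scaled_rotate.
have := scalar_lap (Lam := sphere_integral sigma) (of_zw ('i : K) f) Lrot
  (sphere_integral_norm sigma).
by rewrite (lap_of_zw i2) !euler_of_zw // raddfMn.
Qed.

End Functional.

(** * Patterns *)

Section IntegerSubgroup.
Variable D : set int.
Hypothesis DD : forall x y, D x -> D y -> D (x + y).

Lemma semigroup_mulrn x m : D x -> D (x *+ m.+1).
Proof. by move=> Dx; elim: m => // m IH; rewrite mulrS; exact: DD. Qed.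

(** Such a semigroup is a group: 0 = (-b) a + a b, and for x > 0 one has -x = x b + (-b - 1) x, a
    sum of copies of b and x; x < 0 is symmetric with a. Euclidean division by the least positive
    element d then finishes. *)
Lemma semigroup_int_multiples :
  (exists2 a, D a & 0 < a) -> (exists2 b, D b & b < 0) ->
  exists2 d : int, 0 < d & forall x, D x <-> exists k, x = k * d.
Proof.
move=> [a Da a0] [b Db b0].
have mulpos x (m : int) : 0 < m -> D x -> D (x * m).
  case: m => // [[|m]] // _ Dx.
  by rewrite -[Posz m.+1]natz mulr_natr; exact: semigroup_mulrn.
have D0 : D 0.
  rewrite (_ : 0 = a * - b + b * a); last by ring.
  by apply: DD; apply: mulpos => //; rewrite oppr_gt0.
have DN x : D x -> D (- x).
  move=> Dx; have [x0|x0|->] := ltgtP x 0; last by rewrite oppr0.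
    rewrite (_ : - x = a * - x + x * (a - 1)); last by ring.
    apply: DD; first by apply: mulpos => //; rewrite oppr_gt0.
    have [->|a1] := eqVneq a 1; first by rewrite subrr mulr0.
    by apply: mulpos => //; lia.
  rewrite (_ : - x = b * x + x * (- b - 1)); last by ring.
  apply: DD; first exact: mulpos.
  have [->|b1] := eqVneq b (- 1); first by rewrite opprK subrr mulr0.
  by apply: mulpos => //; lia.
have DZ x m : D x -> D (m * x).
  move=> Dx; have [m0|m0|->] := ltgtP m 0; last by rewrite mul0r.
    by rewrite -[m * x]opprK -mulNr mulrC; apply/DN/mulpos => //; rewrite oppr_gt0.
  by rewrite mulrC; exact: mulpos.
have exP : exists m : nat, (0 < m)%N && `[< D m%:Z >].
  by exists `|a|%N; rewrite absz_gt0 gt_eqF //=; apply/asboolP; rewrite gtz0_abs.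
case: (ex_minnP exP) => d /andP[d0 /asboolP Dd] dmin.
exists d%:Z => // x; split=> [Dx|[k ->]]; last exact: DZ.
exists (x %/ d)%Z; have Dr : D (x %% d)%Z.
  by rewrite /modz -mulNr; apply: DD => //; exact: DZ.
have r0 : 0 <= (x %% d)%Z by apply: modz_ge0; lia.
have rd : (x %% d)%Z < d by apply: ltz_pmod.
rewrite [LHS](divz_eq x d); suff -> : (x %% d)%Z = 0 by rewrite addr0.
apply/eqP; apply: contraTT rd => rn0; rewrite -leNgt.
have := dmin `|x %% d|%Z%N; rewrite absz_gt0 rn0 /= => /(_ _).
have -> : `[< D `|(x %% d)%Z|%N >] by apply/asboolP; rewrite gez0_abs.
by move=> /(_ isT); rewrite -lez_nat gez0_abs.
Qed.

End IntegerSubgroup.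

(** * From closure rules to G(d) *)

Section PatternCombinatorics.
Variable Omega : set (nat * nat).

(** Shared by all dimensions: the set of differences is a group of multiples of some d, and the last
    closure rule says that Omega contains all of [Q_] on every diagonal that it meets. *)
Lemma pattern_of_differences n :
  Omega `<=` Q_ n ->
  (forall p q r s, Omega (p, q) -> Omega (r, s) ->
     exists x y, Omega (x, y) /\ x%:Z - y%:Z = (p%:Z - q%:Z) + (r%:Z - s%:Z)) ->
  (forall p q p' q', Omega (p, q) -> Q_ n (p', q') ->
     p%:Z - q%:Z = p'%:Z - q'%:Z -> Omega (p', q')) ->
  (exists p q, Omega (p, q) /\ (q < p)%N) ->
  (exists r s, Omega (r, s) /\ (r < s)%N) ->
  exists d : int, 0 < d /\ Omega = G_ n d.
Proof.
move=> OQ OD Oshift [p [q [Opq qp]]] [r [s [Ors rs]]].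
pose D : set int := [set x | exists a b, Omega (a, b) /\ a%:Z - b%:Z = x].
have DD x y : D x -> D y -> D (x + y).
  by move=> [a [b [Oab <-]]] [a' [b' [Oab' <-]]]; exact: OD.
have Dpos : exists2 a, D a & 0 < a.
  by exists (p%:Z - q%:Z); [exists p, q | lia].
have Dneg : exists2 b, D b & b < 0.
  by exists (r%:Z - s%:Z); [exists r, s | lia].
have [d d0 Dd] := semigroup_int_multiples DD Dpos Dneg.
exists d; split=> //; apply/seteqP; split=> [[a b] Oab|[a b] [k _ [Qab /= abk]]].
  have [k abk] : exists k, a%:Z - b%:Z = k * d by apply/Dd; exists a, b.
  by exists k => //; split=> //; exact: OQ.
have [a' [b' [Oab' abk']]] : D (k * d) by apply/Dd; exists k.
by apply: Oshift Oab' Qab _; rewrite abk'.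
Qed.

Lemma pattern_shift :
  (forall p q r s, Omega (p, q) -> Omega (r, s) -> Omega (p + r, q + s)%N) ->
  (forall p q r s, Omega (p + r, q + s)%N -> Omega (s, r) -> Omega (p, q)) ->
  (forall p q r s, (q < p)%N -> (r < s)%N -> Omega (p, q) -> Omega (r, s) ->
     Omega (p.-1 + r, q + s.-1)%N) ->
  (exists p q, Omega (p, q) /\ (q < p)%N) ->
  (exists r s, Omega (r, s) /\ (r < s)%N) ->
  forall p q p' q', Omega (p, q) -> p%:Z - q%:Z = p'%:Z - q'%:Z -> Omega (p', q').
Proof.
move=> OD OB Onext [p [q [Opq qp]]] [r [s [Ors rs]]].
have OM m x y : (0 < m)%N -> Omega (x, y) -> Omega (m * x, m * y)%N.
  case: m => // m _ Oxy; elim: m => [|m IH]; first by rewrite !mul1n.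
  by rewrite mulSn [(m.+2 * y)%N]mulSn; exact: OD.
(* The multipliers are chosen so that the two differences are opposite: the sum of the two pairs
   lies on the main diagonal. *)
have O1 := OM (s - r)%N _ _ (ltac:(lia)) Opq.
have O2 := OM (p - q)%N _ _ (ltac:(lia)) Ors.
have l1 : ((s - r) * q < (s - r) * p)%N by rewrite ltn_mul2l qp andbT; lia.
have l2 : ((p - q) * r < (p - q) * s)%N by rewrite ltn_mul2l rs andbT; lia.
have e : ((s - r) * p + (p - q) * r = (s - r) * q + (p - q) * s)%N by nia.
have O11 : Omega (1, 1)%N.
  (* With (c, c) the sum of the two pairs, [Onext] gives (c - 1, c - 1), and removing it from (c, c)
     by [OB] leaves (1, 1). *)
  have := Onext _ _ _ _ l1 l2 O1 O2; have := OD _ _ _ _ O1 O2.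
  move: ((s - r) * p)%N ((s - r) * q)%N ((p - q) * r)%N ((p - q) * s)%N l1 l2 e.
  move=> P Q R S QP RS e.
  rewrite (_ : (P + R = 1 + (P.-1 + R))%N); last by lia.
  rewrite (_ : (Q + S = 1 + (P.-1 + R))%N); last by lia.
  rewrite (_ : (Q + S.-1 = P.-1 + R)%N); last by lia.
  exact: OB.
have up m x y : Omega (x, y) -> Omega (x + m, y + m)%N.
  elim: m x y => [|m IH] x y; first by rewrite !addn0.
  by move=> /IH Oxy; rewrite -addn1 !addnA; exact: OD.
have down m x y : Omega (x + m, y + m)%N -> Omega (x, y).
  elim: m x y => [|m IH] x y; first by rewrite !addn0.
  by rewrite -addn1 !addnA => Oxy; apply: IH; apply: OB Oxy O11.
move=> a b a' b' Oab e'; have [le|lt] := leqP a a'.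
  rewrite (_ : a' = a + (a' - a))%N; last by lia.
  rewrite (_ : b' = b + (a' - a))%N; last by lia.
  exact: up.
apply: (down (a - a')%N); rewrite (_ : a' + (a - a') = a)%N; last by lia.
by rewrite (_ : b' + (a - a') = b)%N; last by lia.
Qed.

End PatternCombinatorics.

(** * Nonzero triple integrals force membership *)

Section PatternTriple.
Local Open Scope complex_scope.
Variables (R : realType) (n : nat).
Variable sigma : probability (borel_sphere R n) R.
Hypothesis sigma_rot : rotation_invariant sigma.
Local Notation K := (R[i] : numFieldType).
Local Notation A := (mpoly (n.+1 + n.+1) K).

Lemma Cintegral_restrM (f g : A) :
  Cintegral sigma
    (fun x => restr (of_zw ('i : K) f) x * restr (of_zw ('i : K) g) x) =
  zw_integral sigma (f * g).
Proof. by rewrite /zw_integral /= /sphere_integral of_zwM restrM. Qed.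

Lemma E_harmonic (Omega : set (nat * nat)) p q (h : sphere R n -> R[i]) :
  Omega (p, q) -> harmonic_space p q h -> E_ Omega h.
Proof.
move=> Opq Hh; exists [:: h]; split; last by apply/funext => x; rewrite big_seq1.
by move=> g; rewrite inE => /eqP ->; exists (p, q).
Qed.

(** If (a, b) were missing, h would be orthogonal to every summand of an element of E_Omega, hence
    to the weak*-closure, which contains the product of f and g. *)
Lemma pattern_triple (Omega : set (nat * nat)) p q r s a b :
  Linfty_algebra_pattern sigma Omega -> Omega (p, q) -> Omega (r, s) ->
  triple_nonzero (zw_integral sigma) (p, q) (r, s) (b, a) -> Omega (a, b).
Proof.
move=> [_ _ _ clM] Opq Ors [f [g [h [Hf Hg Hh fgh0]]]].
apply: contrapT => nOab; apply: fgh0.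
pose F := restr (of_zw ('i : K) f); pose G := restr (of_zw ('i : K) g).
pose H := restr (of_zw ('i : K) h).
have bF : Cbounded_measurable F := Cbounded_measurable_restr _.
have bG : Cbounded_measurable G := Cbounded_measurable_restr _.
have bH : Cbounded_measurable H := Cbounded_measurable_restr _.
have clF : weakstar_closure sigma (E_ Omega) F.
  apply: subset_weakstar_closure; last exact: Cbounded_measurable_LCy.
  by apply: E_harmonic Opq _; apply/harmonic_space_zw; exists f.
have clG : weakstar_closure sigma (E_ Omega) G.
  apply: subset_weakstar_closure; last exact: Cbounded_measurable_LCy.
  by apply: E_harmonic Ors _; apply/harmonic_space_zw; exists g.
have := weakstar_closure_integral0 (Cbounded_measurable_LC1 sigma bH) _
  (clM _ _ clF clG).
rewrite (_ : (fun x => F x * G x * H x) =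
             restr (of_zw ('i : K) (f * g * h))); last first.
  by rewrite !of_zwM !restrM.
apply=> e [u [us ->]] {e}.
have ub v : v \in u -> Cbounded_measurable v.
  by move=> /us[[c e] _ /harmonic_space_zw[w _ ->]]; exact: Cbounded_measurable_restr.
elim: u us ub => [|v u IH] us ub.
  rewrite (_ : (fun x => _) = fun x => 0 * H x); last first.
    by apply/funext => x; rewrite big_nil.
  by rewrite CintegralZ // mul0r.
have bu : Cbounded_measurable (fun x => \sum_(g <- u) g x).
  elim: {IH us} u ub => [|w u IHu] ub.
    rewrite (_ : (fun x => _) = fun=> 0); first exact: Cbounded_measurable_cst.
    by apply/funext => x; rewrite big_nil.
  rewrite (_ : (fun x => _) = fun x => w x + \sum_(g <- u) g x); last first.
    by apply/funext => x; rewrite big_cons.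
  apply: Cbounded_measurableD; first by apply: ub; rewrite !inE eqxx orbT.
  by apply: IHu => t; rewrite !inE => /orP[tv|tu]; apply: ub; rewrite !inE ?tv ?tu ?orbT.
rewrite (_ : (fun x => _) = fun x => v x * H x + (\sum_(g <- u) g x) * H x); last first.
  by apply/funext => x; rewrite big_cons mulrDl.
rewrite CintegralD; [|apply: Cbounded_measurableM => //; apply: ub; exact: mem_head
  |exact: Cbounded_measurableM].
rewrite IH ?addr0; [|by move=> t tu; apply: us; rewrite inE tu orbT
  |by move=> t tu; apply: ub; rewrite inE tu orbT].
have [[c e] /= Oce /harmonic_space_zw[w [wce w0] ->]] := us v (mem_head _ _).
rewrite Cintegral_restrM; case: Hh => hba h0.
apply: (Lam_orth (zw_integral_lap sigma_rot) wce hba w0 h0) => -[bc ae].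
by apply: nOab; rewrite ae bc.
Qed.

End PatternTriple.

Theorem theorem4p10 (R : realType) (n : nat)
    (sigma : probability (borel_sphere R n) R)
    (sigma_rot : rotation_invariant sigma)
    (Omega : set (nat * nat)) (Omega_Q : Omega `<=` Q_ n)
    (Omega_pattern : Linfty_algebra_pattern sigma Omega)
    (Omega_gt : exists p q : nat, Omega (p, q) /\ (q < p)%N)
    (Omega_lt : exists r s : nat, Omega (r, s) /\ (r < s)%N) :
  exists d : int, 0 < d /\ Omega = G_ n d.
Proof.
have Lam1 : zw_integral sigma 1 = 1 := zw_integral1 sigma.
have Lap := zw_integral_lap sigma_rot.
have tri p q r s a b :=
  @pattern_triple _ _ _ sigma_rot Omega p q r s a b Omega_pattern.
apply: pattern_of_differences => //.
  move=> p q r s Opq Ors; case: (posnP n) => [n0|n0]; last first.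
    exists (p + r)%N, (q + s)%N; split; last by lia.
    (* Dimension > 1 provides two distinct coordinates. *)
    have ik : ord0 != ord_max :> 'I_n.+1 by rewrite -val_eqE /=; lia.
    exact: tri Opq Ors (triple_nonzero_top Lam1 Lap p q r s ik).
  have triZ := triple_nonzero_Z Lam1 Lap; have triW := triple_nonzero_W Lam1 Lap.
  (* On the circle z^a conj(z)^b is a power of z or of conj z; the swapped one-variable integral
     detects it. *)
  have mixed a b : Omega (a, 0)%N -> Omega (0, b)%N ->
      exists x y, Omega (x, y) /\ x%:Z - y%:Z = a%:Z - b%:Z.
    move=> Oa Ob; have [ba|ab] := leqP b a.
      exists (a - b)%N, 0%N; split; last by lia.
      apply: tri Oa Ob _; apply: triple_nonzero_swap.
      by rewrite -{2}(subnK ba); exact: triW.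
    exists 0%N, (b - a)%N; split; last by lia.
    apply: tri Ob Oa _; apply: triple_nonzero_swap.
    by rewrite -{2}(subnK (ltnW ab)); exact: triZ.
  have Qpq := Omega_Q _ Opq; have Qrs := Omega_Q _ Ors.
  move: Qpq Qrs Opq Ors; rewrite /Q_ /= n0.
  move=> [//|[-> | ->]] [//|[-> | ->]] Opq Ors.
  - by exists 0%N, (q + s)%N; split; [exact: tri Opq Ors (triW q s) | lia].
  - by have [x [y [Oxy e]]] := mixed _ _ Ors Opq; exists x, y; split=> //; lia.
  - by have [x [y [Oxy e]]] := mixed _ _ Opq Ors; exists x, y; split=> //; lia.
  - by exists (p + r)%N, 0%N; split; [exact: tri Opq Ors (triZ p r) | lia].
(* In dimension 1 the difference determines the pair, so the diagonal has nothing to fill. *)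
move=> p q p' q' Opq Qpq' e; case: (posnP n) => [n0|n0].
  move: (Omega_Q _ Opq) Qpq'; rewrite /Q_ /= n0 => Qpq Qpq'.
  rewrite (_ : p' = p)%N; last by case: Qpq Qpq' => [//|[? | ?]] [//|[? | ?]]; lia.
  by rewrite (_ : q' = q)%N; last by case: Qpq Qpq' => [//|[? | ?]] [//|[? | ?]]; lia.
have ik : ord0 != ord_max :> 'I_n.+1 by rewrite -val_eqE /=; lia.
apply: (@pattern_shift Omega) Opq e => //.
- by move=> p1 q1 r s O1 O2; exact: tri O1 O2 (triple_nonzero_top Lam1 Lap p1 q1 r s ik).
- move=> p1 q1 r s O1 O2; apply: tri O1 O2 _; apply: triple_nonzero_swap.
  exact: (triple_nonzero_top Lam1 Lap q1 p1 s r ik).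
- move=> p1 q1 r s qp rs O1 O2.
  exact: tri O1 O2 (triple_nonzero_subtop Lam1 Lap ik qp rs).
Qed.
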